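(* Let $p$ be a prime, let $B$ be a free abelian group of countably infinite rank, and let $\widehat B$ be its $p$-adic completion. Let $(a_m)_{m<\omega}$ be independent random elements of $\widehat B$ with a nearly uniform distribution in the following sense: there is a real number $\alpha>1$ such that for all $m<\omega$, all $n<\omega$ and all $x\in\widehat B/p^n\widehat B\cong B/p^nB$, $$\mathbb{P}\big[a_m+p^n\widehat B=x\big]\le p^{-n^{\alpha}}.$$ Let $$G:=\big\langle\, B,\ a_m : m<\omega\,\big\rangle_{p*}\subseteq\widehat B.$$ Then $G$ is almost surely a free abelian group.
   Context: For a subgroup $X$ of $\widehat B$, $X_{p*}=\{y\in\widehat B : p^ky\in X\text{ for some }k\in\mathbb{N}\}$ is its $p$-purification, and $\langle\cdots\rangle_{p*}$ is the $p$-purification of the subgroup generated by the listed elements. ''Almost surely'' means with probability $1$. *)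

(* Defs.v *)
From HB Require Import structures.
From mathcomp Require Import all_boot all_order all_algebra.
From mathcomp Require Import all_classical all_reals all_analysis.

Set Implicit Arguments.
Unset Strict Implicit.
Unset Printing Implicit Defensive.

Import Order.TTheory GRing.Theory Num.Theory.

Local Open Scope classical_set_scope.
Local Open Scope ring_scope.
Local Open Scope quotient_scope.

Definition gen_subgroup (V : zmodType) (X : set V) : set V :=
  smallest (fun H : set V => GRing.zmod_closed [in H]) X.

Definition Zindependent (V : zmodType) (S : set V) : Prop :=
  forall (s : seq V) (c : V -> int), uniq s -> [set` s] `<=` S ->
    \sum_(x <- s) x *~ c x = 0 -> forall x, x \in s -> c x = 0.

Definition Zbasis (V : zmodType) (S G : set V) : Prop :=
  Zindependent S /\ gen_subgroup S = G.

(* [G] is (the carrier of) a subgroup of [V] which is free abelian, of any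
   rank; being a subgroup is implied by [gen_subgroup S = G]. *)
Definition free_abelian (V : zmodType) (G : set V) : Prop :=
  exists S, Zbasis S G.

Definition free_abelian_of_countable_rank (V : zmodType) : Prop :=
  exists S : set V, Zbasis S setT /\ (S #= [set: nat])%card.

Definition purification (p : nat) (V : zmodType) (X : set V) : set V :=
  [set y | exists k, X (y *+ p ^ k)].

(* The subgroup p^n V of V. *)
Definition pmultiples (p n : nat) {V : zmodType} : {pred V} :=
  [pred x | `[< exists y : V, x = y *+ p ^ n >]].

Lemma pmultiples_zmod_closed p n V : GRing.zmod_closed (@pmultiples p n V).
Proof.
split=> [|x y]; first by apply/asboolP; exists 0; rewrite mul0rn.
move=> /asboolP[x' ->] /asboolP[y' ->].
by apply/asboolP; exists (x' - y'); rewrite mulrnBl.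
Qed.

HB.instance Definition _ p n V :=
  GRing.isZmodClosed.Build V (@pmultiples p n V) (@pmultiples_zmod_closed p n V).

Definition quo_pmultiples (p : nat) (V : zmodType) (n : nat) : zmodType :=
  Quotient.quot (@pmultiples p n V).

Definition pi_pmultiples (p : nat) (V : zmodType) (n : nat) (x : V) :
    quo_pmultiples p V n :=
  \pi_(Quotient.quot (@pmultiples p n V)) x.

Lemma pi_pmultiplesB p V n : {morph @pi_pmultiples p V n : x y / x - y}.
Proof. exact: raddfB. Qed.

Definition prod_quo_pmultiples (p : nat) (V : zmodType) : Type :=
  forall n, quo_pmultiples p V n.

HB.instance Definition _ p V := Choice.copy (prod_quo_pmultiples p V)
  (forall n, quo_pmultiples p V n).

Lemma prod_quo_addA p V :
  associative (fun (x y : prod_quo_pmultiples p V) n => x n + y n).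
Proof. by move=> x y z; apply: functional_extensionality_dep => n; rewrite addrA. Qed.

Lemma prod_quo_addC p V :
  commutative (fun (x y : prod_quo_pmultiples p V) n => x n + y n).
Proof. by move=> x y; apply: functional_extensionality_dep => n; rewrite addrC. Qed.

Lemma prod_quo_add0 p V : left_id (fun n => 0)
  (fun (x y : prod_quo_pmultiples p V) n => x n + y n).
Proof. by move=> x; apply: functional_extensionality_dep => n; rewrite add0r. Qed.

Lemma prod_quo_addN p V : left_inverse (fun n => 0)
  (fun (x : prod_quo_pmultiples p V) n => - x n)
  (fun (x y : prod_quo_pmultiples p V) n => x n + y n).
Proof. by move=> x; apply: functional_extensionality_dep => n; rewrite addNr. Qed.

HB.instance Definition _ p V := GRing.isZmodule.Build (prod_quo_pmultiples p V)
  (@prod_quo_addA p V) (@prod_quo_addC p V) (@prod_quo_add0 p V)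
  (@prod_quo_addN p V).

(* Threads of the inverse system ... -> V/p^2V -> V/pV -> V/V.  The transition
   map sends a class mod p^n.+1 to the class mod p^n of any representative. *)
Definition coherent (p : nat) (V : zmodType) : {pred prod_quo_pmultiples p V} :=
  [pred x | `[< forall n (v : V),
     x n.+1 = pi_pmultiples p n.+1 v -> x n = pi_pmultiples p n v >]].

Lemma pi_pmultiples_surj p V n (u : quo_pmultiples p V n) :
  exists v, u = pi_pmultiples p n v.
Proof.
exists (repr (u : Quotient.quot (@pmultiples p n V))).
by rewrite /pi_pmultiples reprK.
Qed.

Lemma pi_pmultiples_coh p (V : zmodType) n (v w : V) :
  pi_pmultiples p n.+1 v = pi_pmultiples p n.+1 w ->
  pi_pmultiples p n v = pi_pmultiples p n w.
Proof.
move=> /eqP; rewrite /pi_pmultiples -Quotient.idealrBE => /asboolP[y e].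
apply/eqP; rewrite -Quotient.idealrBE; apply/asboolP.
by exists (y *+ p); rewrite -mulrnA -expnS.
Qed.

Lemma coherent_zmod_closed p V : GRing.zmod_closed (@coherent p V).
Proof.
split=> [|x y /asboolP hx /asboolP hy]; apply/asboolP => n v.
  have pi0 k : 0 = pi_pmultiples p k (0 : V) by rewrite /pi_pmultiples raddf0.
  by rewrite [LHS]pi0 => /pi_pmultiples_coh <-; exact: pi0.
have [vx ex] := pi_pmultiples_surj (x n.+1).
have [vy ey] := pi_pmultiples_surj (y n.+1).
have -> : (x - y) n.+1 = x n.+1 - y n.+1 by [].
have -> : (x - y) n = x n - y n by [].
rewrite (hx _ _ ex) (hy _ _ ey) ex ey -!pi_pmultiplesB.
exact: pi_pmultiples_coh.
Qed.

HB.instance Definition _ p V :=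
  GRing.isZmodClosed.Build (prod_quo_pmultiples p V) (@coherent p V)
    (@coherent_zmod_closed p V).

(* The inverse limit of the V/p^nV, as a subgroup of their product. *)
Record padic_completion (p : nat) (V : zmodType) : Type := PadicCompletion {
  thread :> prod_quo_pmultiples p V;
  thread_coherent : thread \in @coherent p V }.

HB.instance Definition _ p V := [isSub for @thread p V].
HB.instance Definition _ p V := [Choice of padic_completion p V by <:].
HB.instance Definition _ p V :=
  [SubChoice_isSubZmodule of padic_completion p V by <:].

Lemma to_completion_coherent p (V : zmodType) (v : V) :
  (fun n => pi_pmultiples p n v) \in @coherent p V.
Proof. by apply/asboolP => n w; exact: pi_pmultiples_coh. Qed.

Definition to_completion (p : nat) (V : zmodType) (v : V) :
    padic_completion p V :=
  PadicCompletion (to_completion_coherent p v).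

HB.instance Definition _ p V := isPointed.Build (padic_completion p V) 0.

(* The p-adic topology: the cosets x + p^n V form a base of neighbourhoods. *)
Definition padic_open (p : nat) (V : zmodType) : set (set V) :=
  [set U | forall x, U x ->
     exists n, forall y, y - x \in pmultiples p n -> U y].

Lemma padic_openT p V : @padic_open p V setT.
Proof. by move=> x _; exists 0%N. Qed.

Lemma padic_openI p V : setI_closed (@padic_open p V).
Proof.
move=> U W oU oW x [/oU[n hn] /oW[m hm]]; exists (n + m)%N => y /asboolP[z e].
split; [apply: hn | apply: hm]; apply/asboolP.
  by exists (z *+ p ^ m); rewrite -mulrnA mulnC -expnD.
by exists (z *+ p ^ n); rewrite -mulrnA -expnD.
Qed.

Lemma padic_open_bigU p (V : zmodType) (I : Type) (f : I -> set V) :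
  (forall i, padic_open p (f i)) -> padic_open p (\bigcup_i f i).
Proof.
by move=> of_ x [i _ /of_[n hn]]; exists n => y /hn fy; exists i.
Qed.

HB.instance Definition _ p V := isOpenTopological.Build (padic_completion p V)
  (@padic_openT p (padic_completion p V))
  (@padic_openI p (padic_completion p V))
  (@padic_open_bigU p (padic_completion p V)).

Definition borel (E : ptopologicalType) := g_sigma_algebraType (@open E).

(* Mutual independence: the product rule for every finite subfamily. *)
Definition independent_elements d (T : measurableType d) (R : realType)
    (P : probability T R) (I : eqType) d' (E : measurableType d')
    (X : I -> T -> E) : Prop :=
  forall (s : seq I) (A : I -> set E), uniq s ->
    (forall i, measurable (A i)) ->
    (P (\bigcap_(i in [set` s]) (X i @^-1` A i)) =
     \prod_(i <- s) P (X i @^-1` A i))%E.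

Definition purified_group (p : nat) (B : zmodType) (T : Type)
    (a : nat -> T -> padic_completion p B) (w : T) : set (padic_completion p B) :=
  purification p
    (gen_subgroup (range (@to_completion p B) `|` range (fun m => a m w))).

(* Main.v *)
(* Interleave a basis (e_i) of B with the random elements (a_i) into a sequence
   (v_i).  The group G is free as soon as, for every K, some n satisfies: p^n
   divides sum_(i < K) c_i v_i only if p divides all c_i.  Indeed the
   v_i are then independent, the purification of <v_0, ..., v_(K-1)> has bounded
   denominators over <v_0, ..., v_(K-1)>, and a basis of G triangular with
   respect to (v_i) is built one element at a time.
   For given K and n, the failure of the condition depends only on the c_i mod
   p^n, i.e. on p^(nK) choices; as B is p-pure in its completion, some a_j has a
   coefficient prime to p.  Conditionally on the other a_i modulo p^n, p^n
   divides the combination only if a_j lies in a fixed coset of p^n, which has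
   probability at most p^(-n^alpha).  Since alpha > 1, the product
   p^(nK) p^(-n^alpha) tends to 0 as n grows. *)

Require Import Defs.
From HB Require Import structures.
From mathcomp Require Import all_boot all_order all_algebra.
From mathcomp Require Import all_classical all_reals all_analysis.

Set Implicit Arguments.
Unset Strict Implicit.
Unset Printing Implicit Defensive.

Import Order.TTheory GRing.Theory Num.Theory.
Local Open Scope classical_set_scope.
Local Open Scope ring_scope.

(** * Finite integer combinations of a sequence and the subgroup it generates *)

Section FinitaryCombinations.
Variable V : zmodType.
Implicit Types (v : nat -> V) (c : nat -> int) (H X : set V) (x y : V).

Definition lincomb v K c : V := \sum_(i < K) v i *~ c i.

Lemma lincombB v K c1 c2 :
  lincomb v K (c1 \- c2) = lincomb v K c1 - lincomb v K c2.
Proof. by rewrite /lincomb -sumrB; apply: eq_bigr => i _; rewrite mulrzBr. Qed.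

Lemma lincombZ v K c (z : int) :
  lincomb v K (fun i => c i * z) = lincomb v K c *~ z.
Proof.
by rewrite /lincomb mulrz_suml; apply: eq_bigr => i _; rewrite mulrzA.
Qed.

Lemma eq_lincomb v K c1 c2 : (forall i, (i < K)%N -> c1 i = c2 i) ->
  lincomb v K c1 = lincomb v K c2.
Proof. by move=> e; apply: eq_bigr => i _; rewrite e. Qed.

Lemma lincombS v K c : lincomb v K.+1 c = lincomb v K c + v K *~ c K.
Proof. by rewrite /lincomb big_ord_recr. Qed.

Lemma lincomb_widen v K L c : (K <= L)%N ->
  lincomb v K c = lincomb v L (fun i => if (i < K)%N then c i else 0).
Proof.
move=> /subnKC <-; elim: (L - K)%N => [|m IH].
  by rewrite addn0; apply: eq_lincomb => i ->.
by rewrite addnS lincombS -IH ltnNge leq_addr mulr0z addr0.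
Qed.

Lemma lincomb_delta v K i (z : int) : (i < K)%N ->
  lincomb v K (fun j => if j == i then z else 0) = v i *~ z.
Proof.
move=> iK; rewrite /lincomb (bigD1 (Ordinal iK)) //= eqxx big1 ?addr0 // => j.
by rewrite -val_eqE /= => /negPf ->.
Qed.

Lemma gen_subgroup_zmod_closed X : GRing.zmod_closed [in gen_subgroup X].
Proof.
split=> [|x y]; rewrite !inE.
  by move=> H [[H0 _] _]; move: H0; rewrite inE.
move=> hx hy H HX; have := hx H HX; have := hy H HX.
by case: HX => [[_ HB] _] Hy Hx; have := HB x y; rewrite !inE; apply.
Qed.

Lemma sub_gen_subgroup X : X `<=` gen_subgroup X.
Proof. exact: sub_smallest. Qed.

Lemma gen_subgroup_sub X H :
  GRing.zmod_closed [in H] -> X `<=` H -> gen_subgroup X `<=` H.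
Proof. by move=> H_closed XH x; apply; split. Qed.

Lemma zmod_closed_lincomb H v K c :
  GRing.zmod_closed [in H] -> (forall i, H (v i)) -> H (lincomb v K c).
Proof.
move=> Hc Hv.
pose H' : zmodClosed V := HB.pack [in H] (GRing.isZmodClosed.Build V [in H] Hc).
suff: lincomb v K c \in H' by exact: set_mem.
by apply: rpred_sum => i _; rewrite rpredMz //; exact: mem_set.
Qed.

Lemma gen_subgroup_range v :
  gen_subgroup (range v) = [set x | exists K c, x = lincomb v K c].
Proof.
apply/seteqP; split=> [|_ [K [c ->]]]; last first.
  apply: zmod_closed_lincomb; first exact: gen_subgroup_zmod_closed.
  by move=> i; apply: sub_gen_subgroup; exists i.
apply: gen_subgroup_sub => [|_ [i _ <-]]; last first.
  by exists i.+1, (fun j => if j == i then 1 else 0); rewrite lincomb_delta.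
split=> [|x y]; rewrite !inE.
  by exists 0%N, (fun=> 0); rewrite /lincomb big_ord0.
move=> [K [c ->]] [L [c' ->]].
rewrite (lincomb_widen _ _ (leq_maxl K L)) (lincomb_widen _ _ (leq_maxr K L)).
by rewrite -lincombB; eexists; eexists.
Qed.

Lemma lincomb_seq v K (s : seq V) (f : V -> int) :
  injective v -> uniq s -> (forall x, x \in s -> exists2 i, (i < K)%N & v i = x) ->
  \sum_(x <- s) x *~ f x = lincomb v K (fun i => if v i \in s then f (v i) else 0).
Proof.
move=> v_inj s_uniq sK.
have s_perm : perm_eq s [seq v i | i <- iota 0 K & v i \in s].
  apply: uniq_perm => //.
    by rewrite map_inj_uniq // filter_uniq // iota_uniq.
  move=> x; apply/idP/mapP => [xs|[i]]; last by rewrite mem_filter => /andP[? _ ->].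
  have [i iK vi] := sK x xs; exists i => //.
  by rewrite mem_filter mem_iota /= add0n iK vi xs.
rewrite (perm_big _ s_perm) big_map big_filter /lincomb.
rewrite -[K in iota 0 K]subn0 -/(index_iota 0 K).
rewrite big_mkcond big_mkord; apply: eq_bigr => i _.
by case: ifP => //; rewrite mulr0z.
Qed.

Lemma Zbasis_range v :
  (forall K c, lincomb v K c = 0 -> forall i, (i < K)%N -> c i = 0) ->
  Zbasis (range v) (gen_subgroup (range v)).
Proof.
move=> v_indep; split=> // s f s_uniq sv sum0.
(* A repetition [v i = v j] with [i != j] would yield the nontrivial relation [v i - v j = 0]. *)
have v_inj : injective v.
  move=> i j vij; apply/eqP/negP => /negP ij.
  pose K := (maxn i j).+1; have iK : (i < K)%N by rewrite ltnS leq_maxl.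
  have jK : (j < K)%N by rewrite ltnS leq_maxr.
  have /(v_indep _ _)/(_ i iK) : lincomb v K ((fun k => if k == i then 1 else 0) \-
      (fun k => if k == j then 1 else 0)) = 0.
    by rewrite lincombB !lincomb_delta // vij subrr.
  by rewrite /= eqxx (negPf ij) subr0.
have [K sK] : exists K, forall x, x \in s -> exists2 i, (i < K)%N & v i = x.
  elim: s sv {s_uniq sum0} => [|x s IH] sv; first by exists 0%N.
  have [K sK] : exists K, forall x, x \in s -> exists2 i, (i < K)%N & v i = x.
    by apply: IH => y ys; apply: sv; rewrite /= inE ys orbT.
  have [i _ vi] : range v x by apply: sv; rewrite /= inE eqxx.
  exists (maxn K i.+1) => y; rewrite inE => /predU1P[->|/sK[j jK vj]].
    by exists i => //; rewrite leq_max ltnSn orbT.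
  by exists j => //; rewrite leq_max jK.
move=> x xs; have [i iK vi] := sK x xs.
move: sum0; rewrite (lincomb_seq f v_inj s_uniq sK) => /v_indep/(_ i iK).
by rewrite vi xs.
Qed.

End FinitaryCombinations.

(** Subgroups of Z are cyclic: [g] is the least positive element, or 0 if there is none, and
    remainders modulo [g] vanish by minimality. *)
Lemma zmod_closed_dvdz (J : set int) : GRing.zmod_closed [in J] ->
  exists g, J g /\ forall z, J z -> (g %| z)%Z.
Proof.
move=> Jc.
pose J' : zmodClosed int := HB.pack [in J] (GRing.isZmodClosed.Build int [in J] Jc).
have JM z w : J z -> J (z * w).
  move=> /mem_set Jz; apply/set_mem; rewrite -mulrzz.
  exact: (@rpredMz _ J').
have [[n [n0 Jn]]|noJ] := pselect (exists n : nat, (0 < n)%N /\ J n%:Z); last first.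
  exists 0; split=> [|z Jz]; first exact/set_mem/(rpred0 J').
  rewrite dvd0z; apply: contra_notT noJ => z0.
  exists `|z|%N; split; first by rewrite absz_gt0.
  by rewrite abszEsg mulrC; exact: JM.
have exn : exists n : nat, `[< (0 < n)%N /\ J n%:Z >] by exists n; apply/asboolP.
case: (ex_minnP exn) => g /asboolP[g0 Jg] gmin; exists g%:Z; split=> // z Jz.
have Jr : J (z %% g)%Z.
  rewrite /modz; apply/set_mem/(rpredB (S := J')); apply: mem_set => //.
  by rewrite mulrC; exact: JM.
have gN0 : g%:Z != 0 by rewrite -lt0n.
apply/dvdz_mod0P.
have := modz_ge0 z gN0; have := ltz_pmod z (_ : 0 < g%:Z); rewrite ltz_nat => /(_ g0).
case: (z %% g)%Z Jr => // -[|r] // Jr rg _.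
have /gmin : `[< (0 < r.+1)%N /\ J r.+1%:Z >] by exact/asboolP.
by rewrite leqNgt => /negP[]; rewrite -ltz_nat.
Qed.

(** * A criterion for the purification of a generated subgroup to be free *)

Section PurificationFree.
Variables (p : nat) (V : zmodType) (v : nat -> V).
Hypothesis p_prime : prime p.
Hypothesis p_torsion_free : forall x : V, x *+ p = 0 -> x = 0.
Hypothesis v_primitive : forall K, exists n, forall c : nat -> int,
  lincomb v K c \in pmultiples p n -> forall i, (i < K)%N -> (p %| c i)%Z.

Lemma pX_torsion_free n (x : V) : x *+ p ^ n = 0 -> x = 0.
Proof.
by elim: n x => [|n IH] x //; rewrite expnSr mulrnA => /p_torsion_free/IH.
Qed.

Lemma lincomb_divp K (c : nat -> int) :
  (forall i, (i < K)%N -> (p %| c i)%Z) ->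
  exists c' : nat -> int, (forall i, (i < K)%N -> c i = c' i * p) /\
    lincomb v K c = lincomb v K c' *+ p.
Proof.
move=> pc; exists (fun i => (c i %/ p)%Z); split=> [i iK|].
  by rewrite divzK // pc.
rewrite pmulrn -lincombZ; apply: eq_lincomb => i iK.
by rewrite divzK // pc.
Qed.

(** Descent: 0 is divisible by every power of [p], so [p] divides all coefficients of a relation,
    and torsion-freeness allows dividing the relation by [p]. Hence every [p ^ t] divides [c i]; the
    choice [t = |c i| < p ^ t] forces [c i = 0]. *)
Lemma lincomb_eq0 K (c : nat -> int) :
  lincomb v K c = 0 -> forall i, (i < K)%N -> c i = 0.
Proof.
move=> c0 i iK; have [n vP] := v_primitive K.
have pc t : forall c' : nat -> int, lincomb v K c' = 0 ->
    ((p ^ t)%:Z %| c' i)%Z.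
  elim: t => [|t IH] c' c'0; first by rewrite expn0 dvd1z.
  have /lincomb_divp[c'' [e'' e]] : forall j, (j < K)%N -> (p %| c' j)%Z.
    by apply: vP; rewrite c'0; exact: rpred0.
  rewrite e'' // expnSr PoszM dvdz_mul //; apply: IH.
  by apply: p_torsion_free; rewrite -e.
have := pc `|c i|%N _ c0; rewrite /dvdz /= => /dvdn_leq.
case: (posnP `|c i|) => [/eqP|_ /(_ isT)]; first by rewrite absz_eq0 => /eqP.
by rewrite leqNgt ltn_expl // prime_gt1.
Qed.

(** The exponent [n] of primitivity is the bound: if [m > n], then [p ^ n] divides the combination,
    so [p] divides all its coefficients and can be cancelled, which lowers [m] by one. *)
Lemma purification_bounded K : exists n, forall m (y : V) c,
  y *+ p ^ m = lincomb v K c -> exists c', y *+ p ^ n = lincomb v K c'.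
Proof.
have [n vP] := v_primitive K; exists n; elim=> [|m IH] y c yc.
  exists (fun i => c i * (p ^ n)%:Z).
  by rewrite lincombZ -yc expn0 mulr1n pmulrn.
have [mn|nm] := leqP m.+1 n.
  exists (fun i => c i * (p ^ (n - m.+1))%:Z).
  by rewrite lincombZ -yc -pmulrn -mulrnA -expnD subnKC.
have /lincomb_divp[c' [_ e]] : forall i, (i < K)%N -> (p %| c i)%Z.
  apply: vP; rewrite -yc; apply/asboolP; exists (y *+ p ^ (m.+1 - n)).
  by rewrite -mulrnA -expnD subnK // ltnW.
apply: (IH _ c'); apply/eqP; rewrite -subr_eq0; apply/eqP; apply: p_torsion_free.
by rewrite mulrnBl -e -yc -mulrnA -expnSr subrr.
Qed.

(* The coefficients at [v K] of the purification of <v_0, ..., v_K> form a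
   subgroup of p^(-n) Z, which is cyclic; [u] lifts a generator. *)
Lemma purification_step K : exists (u : V),
  (exists n c, u *+ p ^ n = lincomb v K.+1 c /\ c K != 0) /\
  forall m y c, y *+ p ^ m = lincomb v K.+1 c ->
    exists z n c', (y - u *~ z) *+ p ^ n = lincomb v K c'.
Proof.
have [n nP] := purification_bounded K.+1.
pose J := [set z | exists y c, y *+ p ^ n = lincomb v K.+1 c /\ c K = z].
have Jc : GRing.zmod_closed [in J].
  split=> [|z w]; rewrite !inE.
    by exists 0, (fun=> 0); rewrite mul0rn /lincomb big1.
  move=> [y [c [yc <-]]] [y' [c' [yc' <-]]].
  by exists (y - y'), (c \- c'); rewrite mulrnBl yc yc' lincombB.
have [g [[u [c [uc cg]]] gP]] := zmod_closed_dvdz Jc.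
exists u; split.
  (* The generator is nonzero because [v K] itself contributes [p ^ n] to [J]. *)
  exists n, c; split=> //; rewrite cg -dvd0z; apply/negP => g0.
  have /gP : J (p ^ n)%:Z.
    exists (v K), (fun j => if j == K then (p ^ n)%:Z else 0).
    by rewrite eqxx lincomb_delta // pmulrn.
  rewrite (eqP (_ : g == 0)) -?dvd0z // dvd0z eqz_nat expn_eq0.
  by rewrite -leqn0 leqNgt prime_gt0.
move=> m y c1 /nP[c2 yc2]; have /gP/dvdzP[z cz] : J (c2 K) by exists y, c2.
exists z, n, (c2 \- (fun i => c i * z)).
have := lincombB v K.+1 c2 (fun i => c i * z).
rewrite lincombS /= cz cg mulrC subrr mulr0z addr0 => ->.
by rewrite lincombZ -yc2 -uc !pmulrn mulrzBl (mulrzAC z).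
Qed.

Lemma free_abelian_purification :
  free_abelian (purification p (gen_subgroup (range v))).
Proof.
have [u uP] := choice purification_step.
(* Triangularity: up to a power of [p], the coefficient at the last [v k] is a nonzero multiple of
   the coefficient at the last [u k]. This transfers independence from [v] to [u]. *)
have u_pur K c : exists n c', lincomb u K c *+ p ^ n = lincomb v K c' /\
    (forall k, K = k.+1 -> c' k = 0 -> c k = 0).
  elim: K => [|K [n [c' [IH _]]]].
    by exists 0%N, (fun=> 0); rewrite /lincomb !big_ord0.
  have [[m [d [ud d0]]] _] := uP K.
  pose c1 i := (if (i < K)%N then c' i else 0) * (p ^ m)%:Z.
  pose c2 i := d i * (c K * (p ^ n)%:Z).
  exists (n + m)%N, (c1 \- (fun i => c2 i * -1)); split=> [|_ [<-]].
    rewrite lincombB !lincombZ -lincomb_widen // -IH -ud mulrNz opprK mulr1z.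
    rewrite lincombS mulrnDl expnD mulrnA -!pmulrn; congr (_ + _).
    rewrite !pmulrn -!mulrzA; congr (_ *~ _).
    by rewrite PoszM mulrA mulrC.
  rewrite /c1 /c2 /= ltnn mul0r sub0r mulrN1 opprK => /eqP.
  rewrite !mulf_eq0 (negPf d0) eqz_nat expn_eq0.
  by rewrite eqn0Ngt prime_gt0 //= orbF => /eqP.
have u_indep K c : lincomb u K c = 0 -> forall i, (i < K)%N -> c i = 0.
  elim: K => // K IH sum0; have [n [c' [uc' c'P]]] := u_pur K.+1 c.
  have cK : c K = 0.
    by apply: c'P => //; apply: (lincomb_eq0 (K := K.+1)); rewrite -?uc' ?sum0 ?mul0rn.
  move=> i; rewrite ltnS leq_eqVlt => /predU1P[->//|]; apply: IH.
  by move: sum0; rewrite lincombS cK mulr0z addr0.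
exists (range u); suff <- :
    gen_subgroup (range u) = purification p (gen_subgroup (range v)).
  exact: Zbasis_range.
rewrite !gen_subgroup_range; apply/seteqP; split=> [_ [K [c ->]]|y].
  by have [n [c' [uc' _]]] := u_pur K c; exists n, K, c'.
(* Spanning: subtracting a multiple of [u K] removes [v K] from the combination; when nothing is
   left, torsion-freeness gives [y = 0]. *)
move=> [m [K [c]]]; elim: K m c y => [|K IH] m c y yc.
  exists 0%N, (fun=> 0); rewrite /lincomb big_ord0.
  by apply: (@pX_torsion_free m); rewrite yc /lincomb big_ord0.
have [_ /(_ _ _ _ yc)[z [n [c']]]] := uP K.
move=> /IH[L [d yd]]; pose M := maxn L K.+1.
exists M, ((fun i => if (i < L)%N then d i else 0) \-
           (fun i => if i == K then - z else 0)).
rewrite lincombB lincomb_delta; last by rewrite leq_max ltnSn orbT.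
by rewrite -lincomb_widen ?leq_maxl // -yd mulrNz opprK subrK.
Qed.

End PurificationFree.

(** * Divisibility, torsion and density in the p-adic completion *)

Section PadicCompletion.
Variables (p : nat) (B : zmodType).
Implicit Types (b : B) (x y : padic_completion p B).

Lemma pi_pmultiples_eq n b b' :
  (pi_pmultiples p n b = pi_pmultiples p n b') <-> (b - b' \in pmultiples p n).
Proof. by rewrite Quotient.idealrBE; split=> [/eqP|/eqP]. Qed.

Lemma threadB x y n : thread (x - y) n = thread x n - thread y n.
Proof. by []. Qed.

Lemma thread_mulrn x k n : thread (x *+ k) n = thread x n *+ k.
Proof. by elim: k => [|k IH] //; rewrite !mulrSr -IH. Qed.

Lemma completion_ext x y : (forall n, thread x n = thread y n) -> x = y.
Proof. by move=> xy; apply: val_inj; apply: functional_extensionality_dep. Qed.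

Lemma to_completionB : {morph @to_completion p B : b b' / b - b'}.
Proof. by move=> b b'; apply: completion_ext => n; exact: pi_pmultiplesB. Qed.

HB.instance Definition _ :=
  GRing.isZmodMorphism.Build B (padic_completion p B)
    (@to_completion p B) to_completionB.

Lemma pi_pmultiples0 n : pi_pmultiples p n (0 : B) = 0.
Proof. by rewrite /pi_pmultiples raddf0. Qed.

Lemma pi_pmultiples_mulrn n b k :
  pi_pmultiples p n (b *+ k) = pi_pmultiples p n b *+ k.
Proof. exact: raddfMn. Qed.

Lemma thread_leq x m n b : (m <= n)%N ->
  thread x n = pi_pmultiples p n b -> thread x m = pi_pmultiples p m b.
Proof.
move=> /subnKC <-; elim: (n - m)%N => [|k IH]; first by rewrite addn0.
by rewrite addnS => e; apply: IH; have /asboolP := thread_coherent x; apply.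
Qed.

Lemma thread_pmultiples x n : x \in pmultiples p n -> thread x n = 0.
Proof.
move=> /asboolP[y ->]; rewrite thread_mulrn.
have [b ->] := pi_pmultiples_surj (thread y n).
rewrite -pi_pmultiples_mulrn -(pi_pmultiples0 n).
by apply/pi_pmultiples_eq; rewrite subr0; apply/asboolP; exists b.
Qed.

Hypothesis p_torsion_free : forall b, b *+ p = 0 -> b = 0.

(** At level [n + m], [x] is represented by some [p ^ n] times [y m]. Since [B] has no [p]-torsion,
    the class of [y m] mod [p ^ m] is compatible with that of [y m.+1], so these classes form a
    thread, the quotient of [x] by [p ^ n]. *)
Lemma pmultiples_thread x n : thread x n = 0 -> x \in pmultiples p n.
Proof.
move=> xn0.
have lift m : exists b b', thread x (n + m)%N = pi_pmultiples p (n + m) b /\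
    b = b' *+ p ^ n.
  have [b xb] := pi_pmultiples_surj (thread x (n + m)%N).
  have /esym := thread_leq (leq_addr m n) xb; rewrite xn0 -(pi_pmultiples0 n).
  by move=> /pi_pmultiples_eq; rewrite subr0 => /asboolP[b' bb']; exists b, b'.
have [b bP] := choice lift; have [y yP] := choice bP => {lift bP}.
have y_coh : (fun m => pi_pmultiples p m (y m)) \in @coherent p B.
  apply/asboolP => m c /pi_pmultiples_coh <-.
  have [xm bm] := yP m; have [xSm bSm] := yP m.+1.
  apply/pi_pmultiples_eq/asboolP.
  have := thread_leq (leqnSn (n + m)) _; rewrite -addnS => /(_ _ _ xSm).
  rewrite xm => /pi_pmultiples_eq/asboolP[z e]; exists z.
  apply/eqP; rewrite -subr_eq0; apply/eqP.
  apply: (@pX_torsion_free p B p_torsion_free n).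
  by rewrite mulrnBl mulrnBl -bm -bSm e -mulrnA -expnD addnC subrr.
apply/asboolP; exists (PadicCompletion y_coh); apply: completion_ext => m.
have [xm bm] := yP m; rewrite thread_mulrn /= -pi_pmultiples_mulrn -bm.
by rewrite (thread_leq (leq_addl n m) xm).
Qed.

(** One level is lost: if [b] represents [x] at level [n.+1], then [b *+ p] lies in [p ^ n.+1 B], so
    [b] lies in [p ^ n B]. *)
Lemma completion_torsion_free x : x *+ p = 0 -> x = 0.
Proof.
move=> px0; apply: completion_ext => n.
have [b xb] := pi_pmultiples_surj (thread x n.+1).
rewrite (thread_leq (leqnSn n) xb) -[RHS](pi_pmultiples0 n).
apply/pi_pmultiples_eq; rewrite subr0.
have := thread_mulrn x p n.+1; rewrite px0 xb -pi_pmultiples_mulrn.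
rewrite -[LHS](pi_pmultiples0 n.+1) => /esym/pi_pmultiples_eq; rewrite subr0.
move=> /asboolP[z e]; apply/asboolP; exists z; apply/eqP; rewrite -subr_eq0.
by apply/eqP/p_torsion_free; rewrite mulrnBl e -mulrnA -expnSr subrr.
Qed.

Lemma to_completion_dense n x :
  exists b, x - to_completion p b \in pmultiples p n.
Proof.
have [b xb] := pi_pmultiples_surj (thread x n); exists b.
by apply: pmultiples_thread; rewrite threadB xb subrr.
Qed.

(** This is the purity of [B] in its completion. *)
Lemma to_completion_pmultiples n b :
  to_completion p b \in pmultiples p n -> b \in pmultiples p n.
Proof.
move=> /thread_pmultiples; rewrite -(pi_pmultiples0 n) => /pi_pmultiples_eq.
by rewrite subr0.
Qed.

End PadicCompletion.

(** * Bases indexed by the natural numbers *)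

Lemma dvdp_pmultiples p (V : zmodType) (e : nat -> V) K (c : nat -> int) :
  (forall L d, lincomb e L d = 0 -> forall i, (i < L)%N -> d i = 0) ->
  gen_subgroup (range e) = setT ->
  lincomb e K c \in pmultiples p 1 -> forall i, (i < K)%N -> (p %| c i)%Z.
Proof.
move=> e_indep e_gen /asboolP[y]; rewrite expn1.
have : gen_subgroup (range e) y by rewrite e_gen.
rewrite gen_subgroup_range => -[L [d ->]].
rewrite pmulrn -lincombZ (lincomb_widen _ _ (leq_maxl K L)).
rewrite (lincomb_widen e _ (leq_maxr K L)) => /eqP.
rewrite -subr_eq0 -lincombB => /eqP/e_indep cd i iK.
have := cd i; rewrite leq_max iK => /(_ isT) /=.
rewrite iK => /eqP; rewrite subr_eq0 => /eqP ->.
by case: ifP => _; rewrite ?dvdz0 // dvdz_mull.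
Qed.

Lemma basis_torsion_free p (V : zmodType) (e : nat -> V) : (0 < p)%N ->
  (forall L d, lincomb e L d = 0 -> forall i, (i < L)%N -> d i = 0) ->
  gen_subgroup (range e) = setT -> forall x : V, x *+ p = 0 -> x = 0.
Proof.
move=> p0 e_indep e_gen x.
have : gen_subgroup (range e) x by rewrite e_gen.
rewrite gen_subgroup_range => -[L [d ->]].
rewrite pmulrn -lincombZ => /e_indep d0; rewrite /lincomb big1 // => i _.
have /eqP := d0 i (ltn_ord i); rewrite mulf_eq0 eqz_nat eqn0Ngt p0 orbF.
by move=> /eqP ->; rewrite mulr0z.
Qed.

Lemma Zindependent_lincomb (V : zmodType) (e : nat -> V) : injective e ->
  Zindependent (range e) ->
  forall L d, lincomb e L d = 0 -> forall i, (i < L)%N -> d i = 0.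
Proof.
move=> e_inj e_indep L d ed0 i iL; pose s := [seq e j | j <- iota 0 L].
have ds j : (j < L)%N -> (e j \in s) * (index (e j) s = j) .
  move=> jL; split; first by apply: map_f; rewrite mem_iota.
  by rewrite index_map // -[j in index j _](nth_iota L 0 jL)
    index_uniq ?iota_uniq ?size_iota.
have s_uniq : uniq s by rewrite map_inj_uniq // iota_uniq.
(* [Zindependent] takes coefficients indexed by vectors; [index] recovers the position of a vector,
   as [e] is injective. *)
rewrite -[i](ds i iL).2; apply: (e_indep s (fun x => d (index x s))) => //.
- by move=> x /mapP[j _ ->]; exists j.
- rewrite (@lincomb_seq _ e L) //; last first.
    by move=> x /mapP[j]; rewrite mem_iota => jL ->; exists j.
  by rewrite -[RHS]ed0; apply: eq_lincomb => j jL; rewrite (ds j jL).1 (ds j jL).2.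
- exact: (ds i iL).1.
Qed.

Lemma countable_basis (B : zmodType) : free_abelian_of_countable_rank B ->
  exists e : nat -> B, gen_subgroup (range e) = setT /\
    (forall L d, lincomb e L d = 0 -> forall i, (i < L)%N -> d i = 0).
Proof.
move=> [S [[S_indep S_gen]]]; rewrite card_eq_sym.
move=> /card_set_bijP[e [eS e_inj e_surj]].
have e_range : S = range e.
  by apply/seteqP; split=> [x /e_surj //|_ [i _ <-]]; exact: eS.
exists e; split; first by rewrite -e_range.
apply: Zindependent_lincomb; last by rewrite -e_range.
by move=> i j; apply: e_inj; rewrite inE.
Qed.

(** * Auxiliary bounds on measures and congruences modulo [p ^ n] *)

(** The law of total probability. The conditional bound is multiplied out, so that cells of
    probability 0 need no separate treatment. *)
Lemma probability_partition_le d (T : measurableType d) (R : realType)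
    (P : probability T R) (U : nat -> set T) (F : set T) (eps : R) :
  (forall k, measurable (U k)) -> trivIset setT U -> \bigcup_k U k = setT ->
  measurable F ->
  (forall k, P (F `&` U k) <= P (U k) * eps%:E)%E ->
  (P F <= eps%:E)%E.
Proof.
move=> mU tU UT mF FU.
have -> : P F = (\sum_(0 <= k <oo) P (F `&` U k))%E.
  rewrite -[F in LHS]setIT -UT setI_bigcupr measure_semi_bigcup //=.
  - by move=> k; exact: measurableI.
  - exact: trivIset_setIl.
  - by apply: bigcup_measurable => k _; exact: measurableI.
apply: (@le_trans _ _ (\sum_(0 <= k <oo) (eps%:E * P (U k)))%E).
  by apply: lee_nneseries => // k _; rewrite muleC.
rewrite nneseriesZl //.
have <- : P (\bigcup_k U k) = (\sum_(0 <= k <oo) P (U k))%E.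
  by rewrite measure_semi_bigcup // UT.
by rewrite UT probability_setT mule1.
Qed.

Lemma measure_bigsetU_le d (T : measurableType d) (R : realType)
    (mu : {measure set T -> \bar R}) (I : Type) (s : seq I) (F : I -> set T) :
  (forall i, measurable (F i)) ->
  (mu (\big[setU/set0]_(i <- s) F i) <= \sum_(i <- s) mu (F i))%E.
Proof.
move=> mF; elim: s => [|i s IH]; first by rewrite !big_nil measure0.
rewrite !big_cons; apply: le_trans (leeD2l _ IH); apply: measureU2 => //.
by apply: bigsetU_measurable.
Qed.

Lemma pmultiples_sym p n (V : zmodType) (x y : V) :
  x - y \in pmultiples p n -> y - x \in pmultiples p n.
Proof. by rewrite -opprB rpredN. Qed.

Lemma pmultiples_trans p n (V : zmodType) (x y z : V) :
  x - y \in pmultiples p n -> y - z \in pmultiples p n -> x - z \in pmultiples p n.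
Proof. by move=> xy /(rpredD xy); rewrite addrA subrK. Qed.

(** By a Bezout relation between [c] and [p ^ n], [c] is invertible modulo [p ^ n]. *)
Lemma pmultiples_coprime p n (V : zmodType) (x : V) (c : int) : prime p ->
  ~~ (p %| c)%Z -> x *~ c \in pmultiples p n -> x \in pmultiples p n.
Proof.
move=> p_prime pc xc; have /coprimezP[[u w] /= uw] : coprimez c (p ^ n)%:Z.
  rewrite coprimezE /=; case: n {xc} => [|n]; first by rewrite expn0 coprimen1.
  by rewrite coprime_sym coprime_pexpl // prime_coprime.
rewrite -[x]mulr1z -uw mulrzDr mulrC !mulrzA rpredD //; first by rewrite rpredMz.
by apply/asboolP; exists (x *~ w); rewrite pmulrn.
Qed.

(** * The probability that [p ^ n] divides a fixed combination *)

Section PadicRandomElements.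
Variables (p : nat) (B : zmodType) (d : measure_display) (T : measurableType d).
Variables (R : realType) (P : probability T R).
Let E := padic_completion p B.
Variable a : nat -> T -> E.
Hypothesis a_meas : forall m, measurable_fun setT (a m : T -> borel E).

(** Unions of cosets of [p ^ n E]: they are open in the p-adic topology, hence Borel. *)
Definition pX_saturated n (A : set E) :=
  forall x y, A x -> y - x \in pmultiples p n -> A y.

Lemma pX_saturated_measurable n (A : set E) :
  pX_saturated n A -> measurable (A : set (borel E)).
Proof.
move=> satA; apply: sub_sigma_algebra; suff : padic_open p A by [].
by move=> x Ax; exists n => y; exact: satA.
Qed.

Lemma preimage_saturated_measurable n m (A : set E) :
  pX_saturated n A -> measurable (a m @^-1` A).
Proof.
move=> /pX_saturated_measurable mA.
by have := a_meas m measurableT mA; rewrite setTI.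
Qed.

Hypothesis p_prime : prime p.
Hypothesis a_indep : independent_elements P (a : nat -> T -> borel E).

(** Fixing the classes mod [p ^ n] of all [a i] with [i != j] leaves at most one class for [a j],
    because [c j] is invertible mod [p ^ n]. By independence this has conditional probability at
    most [eps]. The sequence [g] keeps the number of cells countable. *)
Lemma lincomb_pmultiples_bound (g : nat -> E) n N j (c : nat -> int) (b : E) (eps : R) :
  (forall x, exists i, x - g i \in pmultiples p n) ->
  (forall x, P [set w | (a j w - x \in pmultiples p n)%R] <= eps%:E)%E ->
  (j < N)%N -> ~~ (p %| c j)%Z ->
  let F := [set w | b + lincomb (a ^~ w) N c \in pmultiples p n] in
  measurable F /\ (P F <= eps%:E)%E.
Proof.
move=> g_dense a_unif jN pcj F.
pose code (x : E) : nat := xget 0%N [set i | x - g i \in pmultiples p n].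
have codeP x : x - g (code x) \in pmultiples p n.
  have [i xi] := g_dense x.
  by apply: (@xgetPex _ 0%N [set i | x - g i \in pmultiples p n]); exists i.
have code_eq x y : y - x \in pmultiples p n -> code y = code x.
  move=> yx; congr xget; apply/seteqP; split=> i /= h.
    exact: pmultiples_trans (pmultiples_sym yx) h.
  exact: pmultiples_trans yx h.
have code_pmultiples x y : code x = code y -> x - y \in pmultiples p n.
  move=> xy; apply: pmultiples_trans (codeP x) _; rewrite xy.
  exact: pmultiples_sym.
pose s := [seq i <- iota 0 N | i != j].
pose U k := [set w | pickle ([seq code (a i w) | i <- s] : seq nat) = k].
(* A single family covers both the cell, over [s], and its intersection with a coset condition on
   [a j], over [j :: s], so that independence applies to each. *)
pose C x (t : seq nat) i : set E :=
  if i == j then [set y | y - x \in pmultiples p n]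
  else [set y | code y = nth 0%N t (index i s)].
have C_sat x t i : pX_saturated n (C x t i).
  rewrite /C; case: ifP => _ y z /=; last by move=> <- /code_eq ->.
  by move=> yx zy; exact: pmultiples_trans zy yx.
have C_meas x t i : measurable (C x t i : set (borel E)).
  exact: pX_saturated_measurable (C_sat x t i).
have s_uniq : uniq s by rewrite filter_uniq // iota_uniq.
have js : j \notin s by rewrite mem_filter eqxx.
have sj i : i \in s -> (i == j) = false.
  by move=> is_; apply/negP => /eqP ij; rewrite -ij is_ in js.
have UE x (t : seq nat) : size t = size s ->
    U (pickle t) = \bigcap_(i in [set` s]) (a i @^-1` C x t i).
  move=> st; apply/seteqP; split=> w.
    move=> /(pcan_inj pickleK) <- i /= is_; rewrite /C sj //=.
    by rewrite (nth_map 0%N) ?index_mem // nth_index.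
  move=> h; congr pickle; apply: (@eq_from_nth _ 0%N); rewrite size_map // => k ks.
  rewrite (nth_map 0%N) //; have := h (nth 0%N s k); rewrite /= mem_nth // => /(_ isT).
  by rewrite /C sj ?mem_nth //= index_uniq.
have Udec k : U k = set0 \/ exists t : seq nat, size t = size s /\ k = pickle t.
  have [[w <-]|/forallNP U0] := pselect (exists w, U k w).
    by right; exists [seq code (a i w) | i <- s]; rewrite size_map.
  by left; apply/seteqP; split=> w //; exact: U0.
have U_meas k : measurable (U k).
  have [->//|[t [st ->]]] := Udec k; rewrite (UE 0 _ st).
  apply: fin_bigcap_measurable => // i _.
  exact: preimage_saturated_measurable (C_sat 0 t i).
have UT : \bigcup_k U k = setT by apply/seteqP; split=> // w _; eexists.
have tU : trivIset setT U by move=> k l _ _ [w [<- <-]].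
pose Cj x := a j @^-1` [set y | y - x \in pmultiples p n].
have Cj_meas x : measurable (Cj x).
  apply: (preimage_saturated_measurable (n := n)) => y z yx zy.
  exact: pmultiples_trans zy yx.
have PU x k : P (Cj x `&` U k) = (P (Cj x) * P (U k))%E.
  have [->|[t [st ->]]] := Udec k; first by rewrite setI0 measure0 mule0.
  have CjE : Cj x = a j @^-1` C x t j by rewrite /C eqxx.
  rewrite (UE x _ st) [in RHS]a_indep // CjE.
  have := a_indep (s := j :: s) (A := C x t); rewrite big_cons /= js s_uniq => <- //.
  rewrite (_ : [set` j :: s] = j |` [set` s]) ?bigcap_setU1 //.
  by apply/seteqP; split=> i; rewrite /= inE => /predU1P.
(* If some [w0] of the cell lies in [F], then on this cell the combination changes mod [p ^ n] only
   by [c j] times the change of [a j], so [F] means that [a j] stays in the class of [a j w0]. *)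
have FU k : F `&` U k = set0 \/ exists x, F `&` U k = Cj x `&` U k.
  have [[w0 [Fw0 Uw0]]|/forallNP FU0] := pselect (exists w, (F `&` U k) w); last first.
    by left; apply/seteqP; split=> w //; exact: FU0.
  right; exists (a j w0).
  have Ucode w i : U k w -> i \in s -> a i w - a i w0 \in pmultiples p n.
    move=> Uw is_; apply: code_pmultiples; have := Uw; rewrite -Uw0.
    by move=> /(pcan_inj pickleK)/eq_in_map; exact.
  have Fdiff w : U k w ->
      b + lincomb (a ^~ w) N c - (b + lincomb (a ^~ w0) N c) - (a j w - a j w0) *~ c j
        \in pmultiples p n.
    move=> Uw; rewrite opprD addrACA subrr add0r /lincomb -sumrB.
    rewrite (bigD1 (Ordinal jN)) //= -mulrzBl addrAC subrr add0r.
    apply: rpred_sum => i ij; rewrite -mulrzBl rpredMz // Ucode //.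
    by rewrite mem_filter mem_iota /= add0n ltn_ord andbT.
  apply/seteqP; split=> w [] /= h Uw; split=> //.
    apply: (pmultiples_coprime p_prime pcj).
    by have := rpredB (rpredB h Fw0) (Fdiff w Uw); rewrite opprB addrC subrK.
  have := rpredD (Fdiff w Uw) (rpredMz (c j) h); rewrite subrK => h'.
  by have := rpredD h' Fw0; rewrite subrK.
have F_meas : measurable F.
  rewrite -[F]setIT -UT setI_bigcupr; apply: bigcup_measurable => k _.
  by have [->//|[x ->]] := FU k; exact: measurableI.
split=> //; apply: (probability_partition_le U_meas) => // k.
have [->|[x ->]] := FU k.
  rewrite measure0 mule_ge0 // lee_fin -lee_fin.
  exact: le_trans (a_unif 0).
by rewrite PU muleC lee_wpmul2l //; exact: a_unif.
Qed.

End PadicRandomElements.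

(** * Interleaved generators, growth estimates and countability of classes *)

Lemma lincomb_interleave (V : zmodType) (x y : nat -> V) K (c : nat -> int) :
  lincomb (fun i => if odd i then y i./2 else x i./2) K.*2 c =
  lincomb x K (fun i => c i.*2) + lincomb y K (fun i => c i.*2.+1).
Proof.
elim: K => [|K IH]; first by rewrite /lincomb !big_ord0 addr0.
rewrite doubleS !lincombS IH /= odd_double /= uphalf_double doubleK.
by rewrite addrACA addrA.
Qed.

Lemma pmultiples_leq p m n (V : zmodType) (x : V) : (m <= n)%N ->
  x \in pmultiples p n -> x \in pmultiples p m.
Proof.
move=> mn /asboolP[y ->]; apply/asboolP; exists (y *+ p ^ (n - m)).
by rewrite -mulrnA -expnD subnK.
Qed.

Lemma lincomb_pmultiples p n (V : zmodType) (v : nat -> V) K (c : nat -> int) :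
  (forall i, (i < K)%N -> ((p ^ n)%:Z %| c i)%Z) -> lincomb v K c \in pmultiples p n.
Proof.
move=> pc; apply: rpred_sum => i _; apply/asboolP.
exists (v i *~ (c i %/ (p ^ n)%:Z)%Z).
by rewrite pmulrn -mulrzA divzK // pc.
Qed.

Lemma to_completion_lincomb p (B : zmodType) (e : nat -> B) K (c : nat -> int) :
  lincomb (fun i => to_completion p (e i)) K c = to_completion p (lincomb e K c).
Proof. by rewrite raddf_sum; apply: eq_bigr => i _; rewrite raddfMz. Qed.

(** This presents the group by a single sequence of generators, as [free_abelian_purification]
    requires. *)
Lemma purified_groupE p (B : zmodType) T (a : nat -> T -> padic_completion p B)
    (w : T) (e : nat -> B) : gen_subgroup (range e) = setT ->
  purified_group a w = purification p (gen_subgroup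
    (range (fun i => if odd i then a i./2 w else to_completion p (e i./2)))).
Proof.
move=> e_gen; congr purification.
pose v i := if odd i then a i./2 w else to_completion p (e i./2).
rewrite -/v; apply/seteqP; split; apply: gen_subgroup_sub;
  try exact: gen_subgroup_zmod_closed.
  move=> _ [[b _ <-]|[m _ <-]]; last first.
    by apply: sub_gen_subgroup; exists m.*2.+1 => //;
      rewrite /v /= odd_double uphalf_double.
  have : gen_subgroup (range e) b by rewrite e_gen.
  rewrite gen_subgroup_range => -[K [c ->]]; rewrite -to_completion_lincomb.
  apply: zmod_closed_lincomb; first exact: gen_subgroup_zmod_closed.
  by move=> i; apply: sub_gen_subgroup; exists i.*2 => //;
    rewrite /v /= odd_double doubleK.
move=> _ [i _ <-]; apply: sub_gen_subgroup; rewrite /v.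
by case: ifP => _; [right; exists i./2|left; exists (e i./2)].
Qed.

Lemma powR_superlinear (R : realType) (p M : nat) (alpha : R) :
  (0 < p)%N -> 1 < alpha -> exists n0, forall n, (n0 <= n)%N ->
  ((p ^ n) ^ M)%:R * p%:R `^ (- (n%:R `^ alpha)) <= (p%:R ^- n : R).
Proof.
move=> p0 a1; have b0 : 0 < alpha - 1 by rewrite subr_gt0.
(* For [n] beyond the [1 / (alpha - 1)]-th power of [M + 1], the [(alpha - 1)]-th power of [n] is at
   least [M + 1]; multiplying by [n] bounds the total exponent of [p] by [- n]. *)
exists (Num.truncn (M.+1%:R `^ (alpha - 1)^-1 : R)).+1 => n n0n.
have n_gt0 : (0 : R) < n%:R by rewrite ltr0n (leq_trans _ n0n).
have nM : M.+1%:R <= n%:R `^ (alpha - 1) :> R.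
  rewrite -[leLHS]powRr1 // -[X in _ `^ X <= _](mulVf (lt0r_neq0 b0)) powRrM.
  apply: ge0_ler_powR; rewrite ?nnegrE ?powR_ge0 ?ltW //.
  by apply: lt_le_trans (truncnS_gt _) _; rewrite ler_nat.
have p_gt0 : (0 : R) < p%:R by rewrite ltr0n.
rewrite -expnM natrX -!powR_mulrn // -powRN -powRD; last first.
  by rewrite (gt_eqF p_gt0) implybT.
apply: ler_powR; first by rewrite ler1n.
rewrite -(mulr_powRB1 (ltW n_gt0) (lt_trans ltr01 a1)) lerBlDr.
rewrite -lerBlDl opprK natrM -[X in _ + X]mulr1 -mulrDr.
by rewrite ler_pM2l // natr1.
Qed.

Lemma ereal_eq0_small (R : realType) (p n0 : nat) (x : \bar R) : (1 < p)%N ->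
  (0 <= x)%E -> (forall n, (n0 <= n)%N -> x <= (p%:R ^- n)%:E)%E -> x = 0%E.
Proof.
move=> p1 x0 xn; apply/eqP; rewrite eq_le x0 andbT; apply/lee_addgt0Pr => e e0.
rewrite add0e; pose n := maxn n0 (Num.truncn e^-1).+1.
apply: le_trans (xn n (leq_maxl _ _)) _; rewrite lee_fin invf_ple ?posrE //; last first.
  by rewrite exprn_gt0 // ltr0n ltnW.
apply: ltW; apply: lt_le_trans (truncnS_gt _) _.
rewrite -natrX ler_nat; apply: leq_trans (leq_maxr n0 _) _.
by rewrite ltnW // ltn_expl.
Qed.

(** By density every class mod [p ^ n] contains an element of [B], and [B] is enumerated by finite
    lists of integer coefficients. One enumeration serves all [n]. *)
Lemma padic_completion_countable_classes p (B : zmodType) (e : nat -> B) :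
  (forall b : B, b *+ p = 0 -> b = 0) -> gen_subgroup (range e) = setT ->
  exists g : nat -> padic_completion p B,
    forall n x, exists i, x - g i \in pmultiples p n.
Proof.
move=> B_tf e_gen.
pose g i : padic_completion p B := to_completion p
  (if unpickle i is Some s then lincomb e (size s) (nth (0 : int) s) else 0).
exists g => n x; have [b xb] := to_completion_dense B_tf n x.
have : gen_subgroup (range e) b by rewrite e_gen.
rewrite gen_subgroup_range => -[K [c bc]].
exists (pickle (mkseq c K)); rewrite /g pickleK size_mkseq.
rewrite (@eq_lincomb _ e K (nth 0 (mkseq c K)) c) -?bc // => i iK.
by rewrite nth_mkseq.
Qed.

(** * Almost sure primitivity and freeness *)

Section AlmostSurelyPrimitive.
Variables (p : nat) (B : zmodType) (d : measure_display) (T : measurableType d).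
Variables (R : realType) (P : probability T R).
Variables (a : nat -> T -> padic_completion p B) (e : nat -> B) (alpha : R).
Hypothesis p_prime : prime p.
Hypothesis e_gen : gen_subgroup (range e) = setT.
Hypothesis e_indep : forall L c, lincomb e L c = 0 -> forall i, (i < L)%N -> c i = 0.
Hypothesis a_meas :
  forall m, measurable_fun setT (a m : T -> borel (padic_completion p B)).
Hypothesis a_indep :
  independent_elements P (a : nat -> T -> borel (padic_completion p B)).
Hypothesis alpha_gt1 : 1 < alpha.
Hypothesis a_unif : forall (m n : nat) (x : padic_completion p B),
  (P [set w | (a m w - x \in pmultiples p n)%R]
     <= (p%:R `^ (- (n%:R `^ alpha)))%:E)%E.

Let v w i := if odd i then a i./2 w else to_completion p (e i./2).

Let B_torsion_free : forall b : B, b *+ p = 0 -> b = 0.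
Proof. exact: basis_torsion_free (prime_gt0 p_prime) e_indep e_gen. Qed.

(** If [p] divided all coefficients of the random elements, it would divide the remaining
    combination of basis elements in the completion, hence in [B] by purity, and so all
    coefficients. *)
Lemma odd_coef_primitive w n K (c : nat -> int) : (0 < n)%N ->
  lincomb (v w) K.*2 c \in pmultiples p n ->
  (exists2 i, (i < K.*2)%N & ~~ (p %| c i)%Z) ->
  exists2 j, (j < K)%N & ~~ (p %| c j.*2.+1)%Z.
Proof.
move=> n0 cn [i iK pci]; apply: contrapT => /forall2NP odd_dvd.
have {}odd_dvd j : (j < K)%N -> (p %| c j.*2.+1)%Z.
  by move=> jK; have [//|/negP] := odd_dvd j; rewrite negbK.
have := pmultiples_leq n0 cn.
rewrite [lincomb _ _ _](lincomb_interleave (fun k => to_completion p (e k)) (a ^~ w)).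
rewrite rpredDr; last by apply: lincomb_pmultiples => j /odd_dvd; rewrite expn1.
rewrite to_completion_lincomb => /(to_completion_pmultiples).
move=> /(dvdp_pmultiples e_indep e_gen) even_dvd.
move: pci iK; rewrite -[i]odd_double_half; case: (odd i) => /=.
  by rewrite add1n ltn_Sdouble => /negP pci /odd_dvd.
by rewrite add0n ltn_double => /negP pci /even_dvd.
Qed.

Let bad n K : set T := [set w | exists2 c : nat -> int,
  lincomb (v w) K.*2 c \in pmultiples p n &
  exists2 i, (i < K.*2)%N & ~~ (p %| c i)%Z].

(* Only the residues mod p^n of the coefficients matter, which leaves
   (p^n)^(2K) events of probability at most p^(-n^alpha) each. *)
Lemma bad_bound n K : (0 < n)%N -> exists D, [/\ measurable D, bad n K `<=` D &
  (P D <= (((p ^ n) ^ K.*2)%:R * p%:R `^ (- (n%:R `^ alpha)))%:E)%E].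
Proof.
move=> n0; set eps := p%:R `^ _.
have eps0 : (0%:E <= eps%:E)%E by rewrite lee_fin powR_ge0.
have pn0 : (0 < p ^ n)%N by rewrite expn_gt0 prime_gt0.
pose I := {ffun 'I_K.*2 -> 'I_(p ^ n).-1.+1}.
pose ext (f : I) i : int := if insub i is Some k then Posz (f k) else 0.
pose F (f : I) := [set w | to_completion p (lincomb e K (fun i => ext f i.*2)) +
  lincomb (a ^~ w) K (fun i => ext f i.*2.+1) \in pmultiples p n].
pose good (f : I) := [exists j : 'I_K, ~~ (p %| ext f j.*2.+1)%Z].
pose G f := if good f then F f else set0.
have [g gP] := padic_completion_countable_classes B_torsion_free e_gen.
have GP f : measurable (G f) /\ (P (G f) <= eps%:E)%E.
  rewrite /G; case: ifP => [/existsP[j pj]|_]; last by rewrite measure0.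
  exact: (lincomb_pmultiples_bound a_meas p_prime a_indep
    (c := fun i => ext f i.*2.+1) _ (gP n) (a_unif j n) (ltn_ord j) pj).
exists (\big[setU/set0]_(f : I) G f); split.
- by apply: bigsetU_measurable => f _; case: (GP f).
- move=> w [c cn pc].
  pose f : I := [ffun k : 'I_K.*2 => inord `|(c k %% (p ^ n)%N)%Z|%N].
  have fE i : (i < K.*2)%N -> ext f i = (c i %% (p ^ n)%N)%Z.
    move=> iK; rewrite /ext insubT ffunE inordK /=; last first.
      rewrite prednK // -ltz_nat gez0_abs ?modz_ge0 //; last by rewrite -lt0n.
      by rewrite ltz_pmod.
    by rewrite gez0_abs // modz_ge0 // -lt0n.
  (* As [n > 0], reduction mod [p ^ n] preserves divisibility by [p]. *)
  have fdvd i : (i < K.*2)%N -> (p %| ext f i)%Z = (p %| c i)%Z.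
    have pq : (p %| (c i %/ (p ^ n)%N)%Z * (p ^ n)%N)%Z.
      by apply: dvdz_mull; exact: (dvdn_exp n0 (dvdnn p)).
    by move=> /fE ->; rewrite [in RHS](divz_eq (c i) (p ^ n)%N) (rpredDl _ pq).
  have fn : lincomb (v w) K.*2 (ext f) \in pmultiples p n.
    have := lincombB (v w) K.*2 c (fun i => (c i %/ (p ^ n)%N)%Z * (p ^ n)%N).
    rewrite (@eq_lincomb _ _ _ _ (ext f)) => [->|i iK /=]; last first.
      by rewrite fE.
    by rewrite rpredB // lincomb_pmultiples // => i _; exact: dvdz_mull.
  rewrite -bigcup_seq; exists f; first by rewrite /= mem_index_enum.
  have [j jK pj] : exists2 j, (j < K)%N & ~~ (p %| ext f j.*2.+1)%Z.
    apply: (odd_coef_primitive n0 fn).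
    by have [i iK pi] := pc; exists i; rewrite // fdvd.
  rewrite /G (_ : good f) /F /=; last by apply/existsP; exists (Ordinal jK).
  move: fn; rewrite [lincomb _ _ _](lincomb_interleave
    (fun k => to_completion p (e k)) (a ^~ w)).
  by rewrite to_completion_lincomb.
- apply: le_trans (measure_bigsetU_le _ _ _) _; first by move=> f; case: (GP f).
  apply: (@le_trans _ _ (\sum_(f : I) eps%:E)%E).
    by apply: lee_sum => f _; case: (GP f).
  by rewrite sumEFin sumr_const card_ffun !card_ord prednK // mulr_natl.
Qed.

Lemma ae_primitive K :
  P.-negligible [set w | forall n, bad n K w].
Proof.
(* [D n] covers [bad n.+1 K], since the bound requires a positive exponent. Intersecting these
   covers gives a measurable null set without any claim that [bad] is measurable. *)
have [D DP] := choice (fun n => bad_bound K (ltn0Sn n)).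
have D_meas n : measurable (D n) by case: (DP n).
exists (\bigcap_n D n); split.
- exact: bigcap_measurable.
- have [n0 n0P] := powR_superlinear K.*2 (prime_gt0 p_prime) alpha_gt1.
  apply: (@ereal_eq0_small _ p n0.+1); rewrite ?prime_gt1 // => -[//|n] n0n.
  have [_ _ PD] := DP n; apply: le_trans (le_trans PD _); last first.
    by rewrite lee_fin n0P // ltnW.
  apply: le_measure; rewrite ?inE //; first exact: bigcap_measurable.
  exact: bigcap_inf.
- by move=> w wbad n _; have [_ sub _] := DP n; exact/sub/wbad.
Qed.

Lemma ae_free_abelian : {ae P, forall w, free_abelian (purified_group a w)}.
Proof.
(* The exceptional sets for all [K] have a negligible union; outside it every [K] has its own [n],
   which may depend on [w]. *)
apply: negligibleS (negligible_bigcup ae_primitive) => w /= not_free.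
apply: contrapT => not_bad; apply: not_free; rewrite (purified_groupE _ _ e_gen).
apply: free_abelian_purification => //.
  by apply: completion_torsion_free; exact: B_torsion_free.
move=> K; apply: contrapT => /forallNP prim; apply: not_bad; exists K => // n.
have /existsNP[c /not_implyP[cn /existsNP[i /not_implyP[iK pci]]]] := prim n.
(* Padding with zeros reaches the even length [K.*2] used in [bad]. *)
exists (fun i => if (i < K)%N then c i else 0).
  by rewrite -lincomb_widen // -addnn leq_addr.
by exists i; [rewrite (leq_trans iK) // -addnn leq_addr | rewrite iK; exact/negP].
Qed.

End AlmostSurelyPrimitive.

Theorem theorem3p7 (p : nat) (hp : prime p)
    (B : zmodType) (hB : free_abelian_of_countable_rank B)
    (R : realType) (d : measure_display) (T : measurableType d)
    (P : probability T R)
    (a : nat -> T -> padic_completion p B)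
    (ha : forall m, measurable_fun setT (a m : T -> borel (padic_completion p B)))
    (hind : independent_elements P (a : nat -> T -> borel (padic_completion p B)))
    (hunif : exists2 alpha : R, 1 < alpha &
       forall (m n : nat) (x : padic_completion p B),
         (P [set w | (a m w - x \in pmultiples p n)%R]
            <= (p%:R `^ (- (n%:R `^ alpha)))%:E)%E) :
  {ae P, forall w, free_abelian (purified_group a w)}.
Proof.
have [e [e_gen e_indep]] := countable_basis hB.
have [alpha alpha_gt1 a_unif] := hunif.
exact: ae_free_abelian hp e_gen e_indep ha hind alpha_gt1 a_unif.
Qed.
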